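(* Let $G$ be a graph on $n$ vertices. Then for every $q \in [0,1]$, $G$ contains one of the following: (i) a relatively $q$-full subgraph on $\lceil qn \rceil$ vertices, or (ii) a relatively $(1-q)$-full subgraph on $\lfloor (1-q)n \rfloor$ vertices, or (iii) a relatively $q$-full subgraph on $\lceil qn \rceil + 1$ vertices and a relatively $(1-q)$-full subgraph on $\lfloor (1-q)n \rfloor + 1$ vertices.
   Context: Graphs are finite and simple. For $q \in [0,1]$, a subgraph $H$ of a graph $G$ is relatively $q$-full if $d_H(v) \geq q\, d_G(v)$ for all $v \in V(H)$, where $d_H(v)$ and $d_G(v)$ denote the degrees of $v$ in $H$ and $G$. (The empty subgraph on $0$ vertices satisfies this vacuously.) *)

(* Defs.v *)
From mathcomp Require Import all_boot all_order all_algebra.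
From mathcomp Require Import reals.

Set Implicit Arguments.
Unset Strict Implicit.
Unset Printing Implicit Defensive.

Import Order.TTheory GRing.Theory Num.Theory.
Local Open Scope ring_scope.

Record sgraph (V : finType) := SGraph {
  adj : rel V;
  adj_sym : symmetric adj;
  adj_irr : irreflexive adj }.

(* Subgraphs are not assumed to be induced, and may be empty. *)
Record subgraph (V : finType) (G : sgraph V) := Subgraph {
  sub_vert : {set V};
  sub_adj : rel V;
  sub_adj_sym : symmetric sub_adj;
  sub_adj_vert : forall x y, sub_adj x y -> (x \in sub_vert) && (y \in sub_vert);
  sub_adj_adj : forall x y, sub_adj x y -> adj G x y }.

Definition deg (V : finType) (G : sgraph V) (v : V) : nat :=
  #|[set w | adj G v w]|.

Definition sub_deg (V : finType) (G : sgraph V) (H : subgraph G) (v : V) : nat :=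
  #|[set w | sub_adj H v w]|.

Definition relatively_full (R : realType) (q : R) (V : finType) (G : sgraph V)
    (H : subgraph G) : Prop :=
  forall v, v \in sub_vert H -> q * (deg G v)%:R <= (sub_deg H v)%:R.

(* The prescribed order k is an integer, as produced by Num.ceil and
   Num.floor. *)
Definition has_full_subgraph (R : realType) (q : R) (V : finType)
    (G : sgraph V) (k : int) : Prop :=
  exists H : subgraph G, relatively_full q H /\ #|sub_vert H|%:Z = k.

(* Main.v *)
(** Write [g_X(v) = d_X(v) - q d(v)], where [d_X(v)] is the number of neighbours
    of [v] in [X].  The subgraph induced on [X] is relatively [q]-full when
    [g_X >= 0] on [X], and the one induced on the complement of [X] is relatively
    [(1-q)]-full when [g_X <= 0] off [X].  Among the sets of size [ceil (q n)],
    let [X] maximise [e(X) - q sum_(v in X) d(v)].  Exchanging [x] in [X] with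
    [y] not in [X] shows [g_X(y) <= g_X(x) + [x ~ y]].  If (i) and (ii) fail,
    there are [x] in [X] and [y] not in [X] with [g_X(x) < 0 < g_X(y)].
    Then [x] is adjacent to every bad vertex outside [X], and each such vertex
    has [g_X < 1], so moving [x] out of [X] repairs them all; symmetrically for
    moving [y] into [X]. *)
Require Import Defs.
From mathcomp Require Import all_boot all_order all_algebra.
From mathcomp Require Import reals.
From mathcomp Require Import lra.

Set Implicit Arguments.
Unset Strict Implicit.
Unset Printing Implicit Defensive.

Import Order.TTheory GRing.Theory Num.Theory.
Local Open Scope ring_scope.

Section InducedSubgraph.
Variables (V : finType) (G : sgraph V).
Implicit Types (S : {set V}) (v x y : V).

Definition induced_adj S : rel V :=
  fun x y => [&& x \in S, y \in S & adj G x y].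

Lemma induced_adj_sym S : symmetric (induced_adj S).
Proof. by move=> x y; rewrite /induced_adj adj_sym andbCA. Qed.

Lemma induced_adj_vert S x y :
  induced_adj S x y -> (x \in S) && (y \in S).
Proof. by case/and3P=> -> ->. Qed.

Lemma induced_adj_adj S x y : induced_adj S x y -> adj G x y.
Proof. by case/and3P. Qed.

Definition induced S : subgraph G :=
  Subgraph (@induced_adj_sym S) (@induced_adj_vert S) (@induced_adj_adj S).

Definition deg_in S v : nat := #|[set w in S | adj G v w]|.

Lemma sub_deg_induced S v : v \in S -> sub_deg (induced S) v = deg_in S v.
Proof.
by move=> vS; apply: eq_card => w; rewrite !inE /= /induced_adj vS.
Qed.

Lemma deg_in_setC S v : (deg_in S v + deg_in (~: S) v = deg G v)%N.
Proof.
rewrite /deg -(cardsID S); congr (_ + _)%N.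
  by apply: eq_card => w; rewrite !inE andbC.
by apply: eq_card => w; rewrite !inE.
Qed.

Lemma deg_in_setU1 S x v : x \notin S ->
  deg_in (x |: S) v = (deg_in S v + adj G v x)%N.
Proof.
move=> xS; rewrite /deg_in (cardsD1 x) !inE eqxx /= addnC.
congr (_ + _)%N; apply: eq_card => w; rewrite !inE.
by case: eqVneq => [->|] //=; rewrite (negPf xS).
Qed.

Lemma deg_in_sum S v : deg_in S v = (\sum_(w in S) adj G v w)%N.
Proof.
rewrite /deg_in -sum1_card big_mkcond [RHS]big_mkcond.
by apply: eq_bigr => w _; rewrite !inE; case: (w \in S); case: (adj G v w).
Qed.

End InducedSubgraph.

Section Excess.
Variables (R : realType) (q : R) (V : finType) (G : sgraph V).
Implicit Types (S : {set V}) (v x y : V).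

Definition excess S v : R := (deg_in G S v)%:R - q * (deg G v)%:R.

Lemma has_full_subgraph_excess S (k : int) :
  #|S|%:Z = k -> (forall v, v \in S -> 0 <= excess S v) ->
  has_full_subgraph q G k.
Proof.
move=> Sk full; exists (induced G S); split=> // v vS.
by rewrite sub_deg_induced // -subr_ge0 full.
Qed.

(** Degrees into [S] and into [~: S] add up to [deg G v], so the surplus of [v] over its [1 - q]
    quota in [~: S] is exactly [- excess S v]. *)
Lemma has_full_subgraph_excessC S (k : int) :
  #|~: S|%:Z = k -> (forall v, v \notin S -> excess S v <= 0) ->
  has_full_subgraph (1 - q) G k.
Proof.
move=> Sk full; exists (induced G (~: S)); split=> // v vS.
rewrite sub_deg_induced //; move: vS; rewrite inE => /full.
by rewrite /excess -(deg_in_setC G S v) natrD; lra.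
Qed.

Lemma excess_setU1 S x v : x \notin S ->
  excess (x |: S) v = excess S v + (adj G v x)%:R.
Proof. by move=> xS; rewrite /excess deg_in_setU1 // natrD addrAC. Qed.

Lemma excess_setD1 S x v : x \in S ->
  excess (S :\ x) v = excess S v - (adj G v x)%:R.
Proof.
by move=> xS; rewrite -{2}(setD1K xS) excess_setU1 ?setD11 // addrK.
Qed.

(* Twice [e(S) - q sum_(v in S) d(v)]. *)
Definition potential S : R :=
  \sum_(v in S) ((deg_in G S v)%:R - 2 * q * (deg G v)%:R).

(** Each edge from [x] to [S] counts twice, in the term of [x] and in that of its other end; hence
    the factor 2, also on [q]. *)
Lemma potential_setU1 S x : x \notin S ->
  potential (x |: S) = potential S + 2 * excess S x.
Proof.
move=> xS; rewrite /potential big_setU1 //= deg_in_setU1 // adj_irr addn0.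
under eq_bigr => v _ do rewrite deg_in_setU1 // natrD addrAC.
rewrite big_split /= -natr_sum.
have <- : deg_in G S x = (\sum_(v in S) adj G v x)%N.
  by rewrite deg_in_sum; apply: eq_bigr => v _; rewrite adj_sym.
by rewrite /excess; lra.
Qed.

Lemma potential_max_excess S x y :
  (forall T : {set V}, #|T| = #|S| -> potential T <= potential S) ->
  x \in S -> y \notin S -> excess S y <= excess S x + (adj G x y)%:R.
Proof.
move=> Smax xS yS; have yZ : y \notin S :\ x by rewrite !inE negb_and yS orbT.
have := Smax (y |: S :\ x); rewrite cardsU1 yZ (cardsD1 x S) xS => /(_ erefl).
(* Both sets are now one-vertex extensions of [S :\ x], so its potential cancels. *)
rewrite -{2}(setD1K xS) !potential_setU1 ?setD11 // !excess_setD1 //.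
by rewrite adj_irr subr0 (adj_sym G y); lra.
Qed.

Lemma exists_potential_max (k : nat) : (k <= #|V|)%N ->
  exists2 S : {set V}, #|S| = k & forall T : {set V}, #|T| = k -> potential T <= potential S.
Proof.
move=> kV; have [S0 /eqP S0k] : exists S0 : {set V}, #|S0| == k.
  have /card_gt0P[S0] : (0 < #|[set S : {set V} | #|S| == k]|)%N.
    by rewrite card_draws bin_gt0.
  by rewrite inE; exists S0.
case: (@arg_maxP _ _ _ S0 (fun S => #|S| == k) potential); first exact/eqP.
by move=> S /eqP Sk Smax; exists S => // T /eqP /Smax.
Qed.

Lemma full_subgraph_trichotomy (k : nat) : (k <= #|V|)%N ->
  has_full_subgraph q G k%:Z \/
  has_full_subgraph (1 - q) G (#|V| - k)%N%:Z \/
  (has_full_subgraph q G (k%:Z + 1) /\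
   has_full_subgraph (1 - q) G ((#|V| - k)%N%:Z + 1)).
Proof.
move=> kV; have [S Sk Smax] := exists_potential_max kV.
have exch x y : x \in S -> y \notin S ->
    excess S y <= excess S x + (adj G x y)%:R.
  by apply: potential_max_excess => T; rewrite Sk; exact: Smax.
have SCk : #|~: S| = (#|V| - k)%N by rewrite cardsCs setCK Sk.
case: (boolP [forall v in S, 0 <= excess S v]) => [/forall_inP full|].
  by left; apply: has_full_subgraph_excess full; rewrite Sk.
case/forall_inPn => x xS; rewrite -ltNge => x_bad; right.
case: (boolP [forall v in ~: S, excess S v <= 0]) => [/forall_inP full|].
  left; apply: (has_full_subgraph_excessC (S := S)); first by rewrite SCk.
  by move=> v vS; apply: full; rewrite inE.
case/forall_inPn => y; rewrite inE -ltNge => yS y_bad; right; split.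
  apply: (has_full_subgraph_excess (S := y |: S)).
    by rewrite cardsU1 yS Sk addnC PoszD.
  move=> v; rewrite excess_setU1 // !inE => /predU1P[->|vS].
    by rewrite adj_irr addr0 ltW.
  (* The new excess [excess S v + adj G v y] is at least [excess S y], which is positive. *)
  by have := exch v y vS yS; lra.
apply: (has_full_subgraph_excessC (S := S :\ x)).
  by rewrite setCD setUC cardsU1 inE xS SCk addnC PoszD.
move=> v; rewrite excess_setD1 // !inE negb_and negbK => /predU1P[->|vS].
  by rewrite adj_irr subr0 ltW.
(* Dually, the new excess [excess S v - adj G v x] is at most [excess S x], which is negative. *)
by have := exch x v xS vS; rewrite (adj_sym G x); lra.
Qed.

End Excess.

Theorem theorem7 (R : realType) (n : nat) (V : finType) (G : sgraph V)
    (hn : #|V| = n) (q : R) (hq : 0 <= q <= 1) :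
  has_full_subgraph q G (Num.ceil (q * n%:R)) \/
  has_full_subgraph (1 - q) G (Num.floor ((1 - q) * n%:R)) \/
  (has_full_subgraph q G (Num.ceil (q * n%:R) + 1) /\
   has_full_subgraph (1 - q) G (Num.floor ((1 - q) * n%:R) + 1)).
Proof.
have [q0 q1] := andP hq.
(* The two prescribed orders sum to [n], as for a set and its complement. *)
have -> : Num.floor ((1 - q) * n%:R) = n%:Z - Num.ceil (q * n%:R).
  have -> : (1 - q) * n%:R = n%:Z%:~R + - (q * n%:R) :> R.
    by rewrite mulrBl mul1r.
  by rewrite floorDzr ?intr_int // intrKfloor ceilNfloor opprK.
have : 0 <= Num.ceil (q * n%:R).
  by rewrite -(ceil0 R) ceil_le // mulr_ge0.
have : Num.ceil (q * n%:R) <= n%:Z.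
  by rewrite ceil_le_int -[leRHS]mul1r ler_wpM2r.
(* The lower bound makes the ceiling a natural number [k]; [k <= n] then makes the subtraction in
   [nat] exact. *)
case: (Num.ceil _) => // k; rewrite lez_nat => kn _.
by rewrite subzn // -hn; apply: full_subgraph_trichotomy; rewrite hn.
Qed.
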